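(* Let $(X,d)$ be a metric space with bounded geometry, fix $x\in X$, and write $V_\delta=V_\delta^x$. (i) If $\lim_{l\to\infty}\frac1l\log V_\delta(l)=0$ for every $\delta>0$, then $h_\infty(X)=0$. (ii) If there exists $\delta>0$ with $\limsup_{l\to\infty}\frac1l\log V_\delta(l)>0$, then $h_\infty(X)=\infty$.
   Context: Bounded geometry: for every $r>0$ there is $C(r)\in\mathbb N$ bounding the cardinality of every closed ball of radius $r$. For $\delta>0$ a $\delta$-path is a sequence $(x_0,\dots,x_n)$ with $d(x_{i-1},x_i)\le\delta$; $[x]_\delta$ is the set of points connected to $x$ by a $\delta$-path; $B_\delta(x_0,n)=\{x_n:\exists\ \delta\text{-path }(x_0,\dots,x_n)\}$. Define $V_\delta^x(l)=\sup_{x_0\in[x]_\delta}|B_\delta(x_0,l)|$. Coarse entropy $h_\infty(X)=\lim_{\delta\to\infty}\lim_{R\to\infty}\limsup_{n\to\infty}\frac1n\log s(n,R,\delta,x_0)$, where $s(n,R,\delta,x_0)$ is the supremum of cardinalities of $R$-separated sets of $\delta$-paths of length $n$ starting at $x_0$, paths compared by $\max_i d(x_i,y_i)$. *)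

(* Defs.v *)
From HB Require Import structures.
From mathcomp Require Import all_boot all_order all_algebra.
From mathcomp Require Import all_classical all_reals all_analysis.
From Stdlib Require List.
Set Implicit Arguments. Unset Strict Implicit. Unset Printing Implicit Defensive.
Import Order.TTheory GRing.Theory Num.Theory.
Local Open Scope classical_set_scope.
Local Open Scope ring_scope.

Section CoarseEntropy.
Variables (R : realType) (X : Type) (d : X -> X -> R).

Definition is_metric : Prop :=
  [/\ (forall x y, 0 <= d x y), (forall x y, d x y = 0 <-> x = y),
      (forall x y, d x y = d y x) &
      (forall x y z, d x z <= d x y + d y z)].

Definition ecard (A : set X) : \bar R :=
  ereal_sup [set ((size l)%:R)%:E |
             l in [set l : seq X | List.NoDup l /\ forall y, List.In y l -> A y]].

Definition bounded_geometry : Prop :=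
  forall r : R, 0 < r -> exists C : nat,
    forall x0 : X, (ecard [set y | (d x0 y <= r)%R] <= (C%:R)%:E)%E.

Definition delta_path (delta : R) (n : nat) (p : nat -> X) : Prop :=
  forall i, (i < n)%N -> d (p i) (p i.+1) <= delta.

Definition delta_class (delta : R) (x : X) : set X :=
  [set y | exists n (p : nat -> X), [/\ p 0%N = x, p n = y & delta_path delta n p]].

Definition delta_ball (delta : R) (x0 : X) (n : nat) : set X :=
  [set y | exists p : nat -> X, [/\ p 0%N = x0, p n = y & delta_path delta n p]].

Definition Vgrowth (delta : R) (x : X) (l : nat) : \bar R :=
  ereal_sup [set ecard (delta_ball delta x0 l) | x0 in delta_class delta x].

Definition path_dist (n : nat) (p q : nat -> X) : R :=
  \big[Num.max/0]_(i < n.+1) d (p i) (q i).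

Definition sep_paths (n : nat) (Rsep delta : R) (x0 : X)
    (l : seq (nat -> X)) : Prop :=
  (forall p, List.In p l -> p 0%N = x0 /\ delta_path delta n p) /\
  (forall i j, (i < j < size l)%N ->
     Rsep < path_dist n (nth (fun _ => x0) l i) (nth (fun _ => x0) l j)).

Definition spath (n : nat) (Rsep delta : R) (x0 : X) : \bar R :=
  ereal_sup [set ((size l)%:R)%:E | l in [set l | sep_paths n Rsep delta x0 l]].

Definition coarse_entropy (x0 : X) : \bar R :=
  lim ((fun delta : R =>
          lim ((fun Rsep : R =>
                  limn_esup (fun n : nat =>
                     ((n%:R)^-1)%:E * lne (spath n Rsep delta x0))%E)
               @ +oo))
       @ +oo).

End CoarseEntropy.

(* Main.v *)
(** (i) A [delta]-path of length [n] is determined, up to distance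
    [2 k delta], by its values at the multiples of [k].  Each sample lies in the
    [delta]-ball of [k] steps about the previous one, so for [Rsep >= 2 k delta]
    there are at most [V(k) ^ (n / k)] separated paths, and the inner limit is
    at most [log V(k) / k], which tends to [0].

    (ii) Suppose [log V(l) / l > c] for [delta0] and arbitrarily large [l].  By
    bounded geometry some [delta0]-ball of [l] steps contains more than
    [exp (c l) / C(Rsep)], hence at least [exp (c l / 2)], [Rsep]-separated
    points.  With steps of size [delta >= m delta0] a trip from the centre to
    such a point and back takes only about [2 l / m] steps, so arbitrary words
    in these loops give an entropy of order [m c], whatever [Rsep] is. *)
Require Import Defs.
From HB Require Import structures.
From mathcomp Require Import all_boot all_order all_algebra.
From mathcomp Require Import all_classical all_reals all_analysis.
From mathcomp Require Import zify ring lra.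
From Stdlib Require List.
Set Implicit Arguments.
Unset Strict Implicit.
Unset Printing Implicit Defensive.
Import Order.TTheory GRing.Theory Num.Theory.
Local Open Scope classical_set_scope.
Local Open Scope ring_scope.

(** * Membership in lists *)

Lemma In_nthP (T : Type) (x0 y : T) (s : seq T) :
  List.In y s <-> exists2 i, (i < size s)%N & nth x0 s i = y.
Proof.
elim: s => [|z s IHs]; first by split=> [|[]].
split=> [[->|ys]|[[|i] /= ilt iy]]; first by exists 0%N.
- by have [i ilt <-] := proj1 IHs ys; exists i.+1.
- by left.
- by right; apply/IHs; exists i.
Qed.

Lemma all_In (T : Type) (p : pred T) (s : seq T) :
  (forall y, List.In y s -> p y) -> all p s.
Proof.
elim: s => //= z s IHs ps; rewrite ps ?IHs//; last by left.
by move=> y ys; apply: ps; right.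
Qed.

Lemma In_filter (T : Type) (p : pred T) (z : T) (s : seq T) :
  List.In z [seq y <- s | p y] -> List.In z s /\ p z.
Proof. by rewrite (List.filter_In p z s). Qed.

(** * Upper limits and extended logarithms *)

Lemma limn_esup_le (R : realType) (u : nat -> \bar R) (r : \bar R) :
  (forall n, (u n <= r)%E) -> (limn_esup u <= r)%E.
Proof.
move=> ur; apply: (@le_trans _ _ (ereal_sup (u @` setT))).
  by apply: ereal_inf_lbound; exists setT => //; exact: filterT.
by apply: ge_ereal_sup => _ [n _ <-].
Qed.

Lemma limn_esup_ge (R : realType) (u : nat -> \bar R) (r : \bar R) :
  (forall N, exists2 n, (N <= n)%N & (r <= u n)%E) -> (r <= limn_esup u)%E.
Proof.
move=> ru; apply: le_ereal_inf_tmp => _ [A [N _ NA] <-].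
have [n Nn rn] := ru N; apply: le_ereal_sup_tmp.
by exists (u n) => //; exists n => //; exact: NA.
Qed.

Lemma limn_esup_gt_frequently (R : realType) (u : nat -> \bar R) (r : \bar R) :
  (r < limn_esup u)%E -> forall N, exists2 n, (N <= n)%N & (r < u n)%E.
Proof.
move=> ru N.
have : (r < ereal_sup (u @` [set n | (N <= n)%N]))%E.
  apply: (lt_le_trans ru); apply: ereal_inf_lbound.
  by exists [set n | (N <= n)%N] => //; exact: nbhs_infty_ge.
by move=> /ereal_sup_gt[_ [n Nn <-]] rn; exists n.
Qed.

Lemma le_limn_esup (R : realType) (u v : nat -> \bar R) :
  (forall n, (u n <= v n)%E) -> (limn_esup u <= limn_esup v)%E.
Proof.
move=> uv; apply: le_ereal_inf_tmp => _ [A Aoo <-].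
apply: (@le_trans _ _ (ereal_sup (u @` A))).
  by apply: ereal_inf_lbound; exists A.
apply: ge_ereal_sup => _ [n An <-]; apply: le_ereal_sup_tmp.
by exists (v n) => //; exists n.
Qed.

Lemma lne_le_expR (R : realType) (y : \bar R) (r : R) :
  (y <= (expR r)%:E)%E -> (lne y <= r%:E)%E.
Proof.
case: y => [y||]; [rewrite /=|by rewrite leye_eq|by move=> _; exact: leNye].
case: ifPn => [_ _|]; first by rewrite leNye.
rewrite -ltNge lee_fin => y0 yr; rewrite lee_fin -[leRHS]expRK.
by rewrite ler_ln ?posrE ?expR_gt0.
Qed.

Lemma lne_ge_expR (R : realType) (y : \bar R) (r : R) :
  ((expR r)%:E <= y)%E -> (r%:E <= lne y)%E.
Proof.
case: y => [y||]; [rewrite /=|by move=> _; exact: leey|by rewrite leeNy_eq].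
rewrite lee_fin => ry; have y0 := lt_le_trans (expR_gt0 r) ry.
rewrite ifF ?lee_fin; last by rewrite leNgt y0.
by rewrite -[leLHS]expRK ler_ln ?posrE ?expR_gt0.
Qed.

Lemma le_lne (R : realType) (y z : \bar R) : (y <= z)%E -> (lne y <= lne z)%E.
Proof.
case: z => [z||]; [|by move=> _; exact: leey|by rewrite leeNy_eq => /eqP ->].
case: y => [y||]; [rewrite /=|by rewrite leye_eq|by move=> _; exact: leNye].
rewrite lee_fin /= => yz; case: ifPn => [|]; first by rewrite leNye.
rewrite -ltNge => y0; have z0 := lt_le_trans y0 yz.
rewrite ifF ?lee_fin; last by rewrite leNgt z0.
by rewrite ler_ln ?posrE.
Qed.

(** At [n = 0] the convention [0^-1 = 0] makes the rate 0, which is where [0 <= r] enters. *)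
Lemma growth_rate_le (R : realType) (n : nat) (y : \bar R) (r : R) :
  0 <= r -> (y <= (expR (n%:R * r))%:E)%E ->
  (((n%:R)^-1)%:E * lne y <= r%:E)%E.
Proof.
case: n => [|n] r0 yr; first by rewrite invr0 mul0e.
by rewrite lee_pdivrMl ?ltr0n// -EFinM; exact: lne_le_expR.
Qed.

Lemma growth_rate_ge (R : realType) (n : nat) (y : \bar R) (r : R) :
  (0 < n)%N -> ((expR (n%:R * r))%:E <= y)%E ->
  (r%:E <= ((n%:R)^-1)%:E * lne y)%E.
Proof.
by move=> n0 yr; rewrite lee_pdivlMl ?ltr0n// -EFinM; exact: lne_ge_expR.
Qed.

Section Paths.
Variables (R : realType) (X : Type) (d : X -> X -> R).
Hypothesis dM : is_metric d.

(** * Cardinalities and separated subsets *)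

Lemma size_le_ecard (A : set X) (l : seq X) :
  List.NoDup l -> (forall y, List.In y l -> A y) ->
  ((size l)%:R%:E <= ecard R A)%E.
Proof. by move=> ul lA; apply: ereal_sup_ubound; exists l. Qed.

Lemma ecard_gt (A : set X) (r : R) : (r%:E < ecard R A)%E ->
  exists l : seq X,
    [/\ List.NoDup l, (forall y, List.In y l -> A y) & r < (size l)%:R].
Proof.
by move=> /ereal_sup_gt[_ [l [ul lA] <-]]; rewrite lte_fin => rl; exists l.
Qed.

(* A maximal duplicate-free list of elements of [A] exhausts [A]; the code of
   an element is its position in that list. *)
Lemma ecard_code (x0 : X) (A : set X) (V : nat) : (ecard R A <= V.+1%:R%:E)%E ->
  exists c : X -> 'I_V.+1, forall y z, A y -> A z -> c y = c z -> y = z.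
Proof.
move=> AV.
pose P := fun n : nat => `[< exists l : seq X,
  [/\ List.NoDup l, (forall y, List.In y l -> A y) & size l = n] >].
have exP : exists n, P n.
  by exists 0%N; apply/asboolP; exists [::]; split=> //; exact: List.NoDup_nil.
have ubP n : P n -> (n <= V.+1)%N.
  move=> /asboolP[l [ul lA <-]]; rewrite -(ler_nat R) -lee_fin.
  exact: le_trans (size_le_ecard ul lA) AV.
case: (ex_maxnP exP ubP) => n Pn maxn.
have nV := ubP _ Pn; move/asboolP: Pn => [l [ul lA ln]].
have Al y : A y -> List.In y l.
  move=> Ay; apply: contrapT => yl.
  suff /maxn : P n.+1 by rewrite ltnn.
  apply/asboolP; exists (y :: l); split => /=; last by rewrite ln.
    by constructor.
  by move=> z [<-//|/lA].
have /choice[c cE] y : exists i : 'I_V.+1, A y -> nth x0 l i = y.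
  have [Ay|nAy] := pselect (A y); last by exists ord0.
  have [i ilt ily] := (In_nthP x0 y l).1 (Al _ Ay).
  have iV : (i < V.+1)%N by rewrite (leq_trans ilt)// ln.
  by exists (Ordinal iV).
by exists c => y z Ay Az cyz; rewrite -(cE _ Ay) -(cE _ Az) cyz.
Qed.

(* Greedy selection: keep the head, discard the points within [r] of it. *)
Lemma separated_sublist (r : R) (C : nat) (l : seq X) :
  0 <= r -> (forall y, (ecard R [set z | (d y z <= r)%R] <= C%:R%:E)%E) ->
  List.NoDup l ->
  exists S : seq X, [/\ pairwise (fun y z => r < d y z) S,
    (forall y, List.In y S -> List.In y l) & (size l <= C * size S)%N].
Proof.
move=> r0 dC; have [n] := ubnP (size l); elim: n l => // n IHn [|y l] ln ul.
  by exists [::].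
pose far : pred X := fun z => r < d y z.
have ul' : List.NoDup l by inversion ul.
have [||S [sepS Sl lS]] := IHn [seq z <- l | far z].
- by rewrite (@leq_ltn_trans (size l))// size_filter count_size.
- exact: List.NoDup_filter.
exists (y :: S); split.
- rewrite pairwise_cons sepS andbT; apply: all_In => z zS.
  by have [] := In_filter (Sl _ zS).
- move=> z /= [->|zS]; first by left.
  by have [] := In_filter (Sl _ zS); right.
- have fary : far y = false.
    by case: dM => _ d0 _ _; rewrite /far (d0 y y).2// ltNge r0.
  (* The discarded points, [y] itself included, lie in the closed ball of radius [r] about [y], so
     each kept point costs at most [C]. *)
  rewrite -(count_predC far) addnC mulnS -!size_filter leq_add//; last first.
    by rewrite /= fary.
  rewrite -(ler_nat R) -lee_fin; apply: le_trans (dC y).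
  apply: size_le_ecard; first exact: (List.NoDup_filter (predC far) ul).
  by move=> z zl; have [_] := In_filter zl; rewrite /= -leNgt.
Qed.

(** * Paths and separated families of paths *)

Lemma path_lipschitz (delta : R) (n : nat) (p : nat -> X) (i k : nat) :
  delta_path d delta n p -> (i + k <= n)%N ->
  d (p i) (p (i + k)%N) <= k%:R * delta.
Proof.
case: dM => _ d0 _ dT pp; elim: k => [|k IHk] ikn.
  by rewrite addn0 mul0r (d0 _ _).2.
apply: (le_trans (dT _ (p (i + k)%N) _)).
rewrite -natr1 mulrDl mul1r lerD ?IHk//; first by lia.
by rewrite addnS; apply: pp; lia.
Qed.

Lemma spath_ge1 (n : nat) (Rsep delta : R) (x : X) :
  0 <= delta -> (1 <= spath d n Rsep delta x)%E.
Proof.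
case: dM => _ d0 _ _ delta0.
apply: ereal_sup_ubound; exists [:: fun=> x] => //; split.
  by move=> p [<-|//]; split=> // i _; rewrite (d0 _ _).2.
by move=> i j /= /andP[]; lia.
Qed.

Lemma le_spath (n : nat) (r s delta : R) (x : X) : r <= s ->
  (spath d n s delta x <= spath d n r delta x)%E.
Proof.
move=> rs; apply: ereal_sup_le => _ [l [lp lsep] <-]; exists l => //.
by split=> // i j ij; apply: le_lt_trans rs _; exact: lsep.
Qed.

(** Enumerating [T] without repetition turns distinct labels into distinct positions, the form of
    separation used by [sep_paths]. *)
Lemma spath_family (T : finType) (f : T -> nat -> X) (n : nat)
    (Rsep delta : R) (x : X) :
  (forall t, f t 0%N = x /\ delta_path d delta n (f t)) ->
  (forall t u, t != u -> Rsep < path_dist d n (f t) (f u)) ->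
  (#|T|%:R%:E <= spath d n Rsep delta x)%E.
Proof.
move=> fp fsep.
have [e ue <-] : exists2 e : seq T, uniq e & size e = #|T|.
  by exists (enum T); rewrite ?enum_uniq// -cardE.
apply: ereal_sup_ubound; exists [seq f t | t <- e]; last by rewrite size_map.
split=> [p|i j /andP[ij]].
  by move=> /(@List.in_map_iff T _ f e p)[t [<- _]].
rewrite size_map => jT; have iT := ltn_trans ij jT.
pose t0 := tnth (in_tuple e) (Ordinal jT).
rewrite !(nth_map t0)//; apply: fsep.
by rewrite nth_uniq// ltn_eqF.
Qed.

Lemma path_dist_ge (n : nat) (p q : nat -> X) (i : nat) : (i <= n)%N ->
  d (p i) (q i) <= path_dist d n p q.
Proof.
move=> ile; exact: (le_bigmax 0 (fun j : 'I_n.+1 => d (p j) (q j))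
  (Ordinal (ile : (i < n.+1)%N))).
Qed.

(** * Upper bound by sampling *)

Lemma path_in_class (delta : R) (n : nat) (p : nat -> X) (i : nat) :
  delta_path d delta n p -> (i <= n)%N -> delta_class d delta (p 0%N) (p i).
Proof.
by move=> pp ile; exists i, p; split=> // j ji; apply: pp; exact: leq_trans ile.
Qed.

(** Each sample is coded relative to the previous one, so a path yields a word of length [n %/ k]
    over ['I_V.+1]. The common starting point lets equal words be decoded into equal samples, and
    separation then makes the coding injective. *)
Lemma spath_le_sampling (n k V : nat) (Rsep delta : R) (x : X) :
  (0 < k)%N -> 0 <= delta ->
  (forall y, delta_class d delta x y ->
     (ecard R (delta_ball d delta y k) <= V.+1%:R%:E)%E) ->
  k%:R * delta * 2 <= Rsep ->
  (spath d n Rsep delta x <= (V.+1 ^ (n %/ k))%:R%:E)%E.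
Proof.
case: (dM) => _ d0 dC dT k0 delta0 ballV kR.
have /choice[code codeP] y : exists c : X -> 'I_V.+1,
    delta_class d delta x y ->
    forall u v, delta_ball d delta y k u -> delta_ball d delta y k v ->
      c u = c v -> u = v.
  have [xy|nxy] := pselect (delta_class d delta x y); last first.
    by exists (fun=> ord0).
  by have [c cP] := ecard_code x (ballV y xy); exists c.
apply: ge_ereal_sup => _ [l [lp lsep] <-]; rewrite lee_fin ler_nat.
set q := (n %/ k)%N.
have qkn : (q * k <= n)%N by exact: leq_divM.
pose P i := nth (fun=> x) l i.
have PP i : (i < size l)%N -> P i 0%N = x /\ delta_path d delta n (P i).
  by move=> il; apply/lp/(In_nthP (fun=> x)); exists i.
pose F (i : 'I_(size l)) :=
  [ffun j : 'I_q => code (P i (j * k)%N) (P i (j.+1 * k)%N)].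
suff /leq_card : injective F by rewrite card_ffun !card_ord.
(* Separation is only stated for increasing positions; the other order follows by symmetry of
   [F i = F j]. *)
have Flt (i j : 'I_(size l)) : F i = F j -> (i < j)%N -> False.
  move=> Fij ij.
  have [Pi0 Pi] := PP _ (ltn_ord i); have [Pj0 Pj] := PP _ (ltn_ord j).
  have sample t : (t <= q)%N -> P i (t * k)%N = P j (t * k)%N.
    elim: t => [|t IHt] tq; first by rewrite !mul0n Pi0 Pj0.
    have tkn : (t.+1 * k <= n)%N.
      by rewrite (leq_trans _ qkn)// leq_mul2r tq orbT.
    have tkn' : (t * k <= n)%N.
      by rewrite (leq_trans _ tkn)// leq_mul2r leqnSn orbT.
    have E := IHt (ltnW tq).
    have inB p : delta_path d delta n p ->
        delta_ball d delta (p (t * k)%N) k (p (t.+1 * k)%N).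
      move=> pp; exists (fun r => p (t * k + r)%N); split.
      - by rewrite addn0.
      - by rewrite mulSn addnC.
      - by move=> r rk; rewrite addnS; apply: pp; rewrite mulSn in tkn; lia.
    apply: (codeP (P i (t * k)%N)).
    - by rewrite -Pi0; exact: path_in_class Pi _.
    - exact: inB.
    - by rewrite E; exact: inB.
    - have /ffunP/(_ (Ordinal tq)) := Fij; rewrite !ffunE /= => ->.
      by rewrite E.
  have := lsep i j; rewrite ij ltn_ord => /(_ isT).
  rewrite ltNge => /negP; apply.
  apply: bigmax_le => [|s _]; first by apply: le_trans kR; rewrite !mulr_ge0.
  apply: le_trans kR.
  (* Time [s] is compared with the last sample before it; as [s %% k < k], this also covers the
     incomplete final block. *)
  set t := (s %/ k)%N.
  have tq : (t <= q)%N by rewrite leq_div2r// -ltnS.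
  have sE : nat_of_ord s = (t * k + s %% k)%N by rewrite /t -divn_eq.
  have close p : delta_path d delta n p ->
      d (p (t * k)%N) (p s) <= k%:R * delta.
    move=> pp; rewrite sE; apply: le_trans (path_lipschitz pp _) _.
      by rewrite -sE -ltnS.
    by rewrite ler_wpM2r// ler_nat ltnW// ltn_mod.
  apply: le_trans (dT _ (P i (t * k)%N) _) _.
  rewrite mulr_natr mulr2n lerD//; first by rewrite dC; exact: close.
  by rewrite sample//; exact: close.
move=> i j Fij; apply/val_inj; have [ij|ij|//] := ltngtP i j.
  by have := Flt _ _ Fij ij.
by have := Flt _ _ (esym Fij) ij.
Qed.

Lemma ecard_le_Vgrowth (delta : R) (x y : X) (l : nat) :
  delta_class d delta x y ->
  (ecard R (delta_ball d delta y l) <= Vgrowth d delta x l)%E.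
Proof. by move=> xy; apply: ereal_sup_ubound; exists y. Qed.

(** One scale [k] with [V(k) < exp (k * eps)] suffices: sampling at that scale bounds the rate for
    every [n]. *)
Lemma path_entropy_le (delta eps : R) (x : X) : 0 < delta -> 0 < eps ->
  (limn_esup (fun l : nat => ((l%:R)^-1)%:E * lne (Vgrowth d delta x l))
     < eps%:E)%E ->
  exists Rsep : R,
    (limn_esup (fun n => ((n%:R)^-1)%:E * lne (spath d n Rsep delta x))
       <= eps%:E)%E.
Proof.
move=> delta0 eps0 /ereal_inf_lt[_ [A [N _ NA] <-] Aeps].
pose k := N.+1; have k0 : (0 : R) < k%:R by rewrite ltr0n.
have : ((k%:R^-1)%:E * lne (Vgrowth d delta x k) < eps%:E)%E.
  apply: le_lt_trans Aeps; apply: ereal_sup_ubound; exists k => //.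
  by apply: NA; rewrite /= leqnSn.
rewrite lte_pdivrMl// -EFinM => Vk.
set E := expR (k%:R * eps) in Vk.
have VE : (Vgrowth d delta x k <= E%:E)%E.
  rewrite leNgt; apply/negP => /ltW/lne_ge_expR.
  by rewrite leNgt Vk.
have E1 : 1 <= E by rewrite -expR0 ler_expR mulr_ge0// ltW.
have E0 : 0 <= E by apply: le_trans E1.
(* Cardinalities are integers, so [E] may be truncated; [E >= 1] keeps the result of the form
   [V.+1]. *)
pose V := (Num.truncn E).-1.
have VS : V.+1 = Num.truncn E by rewrite prednK// truncn_gt0.
exists (k%:R * delta * 2); apply: limn_esup_le => n.
apply: growth_rate_le; first exact: ltW.
apply: le_trans (@spath_le_sampling n k V _ delta x _ _ _ _) _ => //.
- exact: ltW.
- move=> y xy; apply: ge_ereal_sup => _ [l lP <-].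
  rewrite lee_fin ler_nat VS truncn_ge_nat// -lee_fin.
  apply: le_trans VE; apply: le_trans (ecard_le_Vgrowth k xy).
  by apply: ereal_sup_ubound; exists l.
- rewrite lee_fin natrX VS.
  apply: (@le_trans _ _ (E ^+ (n %/ k))).
    by rewrite lerXn2r ?nnegrE// truncn_le.
  rewrite /E -expRM_natl ler_expR mulrA -natrM ler_wpM2r//; first exact: ltW.
  by rewrite ler_nat leq_divM.
Qed.

(** * Lower bound by words in loops *)

Lemma path_dist_le (delta : R) (n m i j : nat) (p : nat -> X) :
  0 <= delta -> delta_path d delta n p -> (i <= n)%N -> (j <= n)%N ->
  (i <= j + m)%N -> (j <= i + m)%N -> d (p i) (p j) <= m%:R * delta.
Proof.
case: (dM) => _ _ dC _ delta0 pp.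
wlog ij : i j / (i <= j)%N => [wl|] ile jle ijm jim.
  by have [/wl|/ltnW/wl] := leqP i j; [|rewrite dC]; apply.
rewrite -(subnKC ij); apply: le_trans (path_lipschitz pp _) _.
  by rewrite subnKC.
by rewrite ler_wpM2r// ler_nat; lia.
Qed.

(* Follows [p] at speed [m], waits at [p l] until time [K], and returns. *)
Definition there_and_back (l m : nat) (p : nat -> X) : nat -> X :=
  let K := (l %/ m).+1 in fun r => p (minn l (m * minn r (2 * K - r))).

Lemma there_and_back0 (l m : nat) (p : nat -> X) :
  there_and_back l m p 0 = p 0%N.
Proof. by rewrite /there_and_back min0n muln0 minn0. Qed.

Lemma there_and_backN (l m : nat) (p : nat -> X) :
  there_and_back l m p (2 * (l %/ m).+1) = p 0%N.
Proof. by rewrite /there_and_back subnn minn0 muln0 minn0. Qed.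

Lemma there_and_back_half (l m : nat) (p : nat -> X) : (0 < m)%N ->
  there_and_back l m p (l %/ m).+1 = p l.
Proof.
move=> m0; rewrite /there_and_back mul2n -addnn addnK minnn.
(* Since [l < (l %/ m).+1 * m], the cap [l] is in force at the turning time. *)
by rewrite (minn_idPl _)// mulnC ltnW// ltn_ceil.
Qed.

(** The tent [minn r (b - r)] changes by at most 1 per step, so the index into [p] moves by at most
    [m]. *)
Lemma delta_path_there_and_back (delta0 delta : R) (l m : nat) (p : nat -> X) :
  0 <= delta0 -> m%:R * delta0 <= delta -> delta_path d delta0 l p ->
  delta_path d delta (2 * (l %/ m).+1) (there_and_back l m p).
Proof.
move=> delta00 mdelta pp i; rewrite /there_and_back; set b := (2 * _)%N => ib.
apply: le_trans mdelta; apply: (path_dist_le delta00 pp); rewrite ?geq_minl//.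
- have : (m * minn i (b - i) <= m * minn i.+1 (b - i.+1) + m)%N.
    by rewrite -mulnSr leq_mul2l; apply/orP; right; lia.
  by lia.
- have : (m * minn i.+1 (b - i.+1) <= m * minn i (b - i) + m)%N.
    by rewrite -mulnSr leq_mul2l; apply/orP; right; lia.
  by lia.
Qed.

(** Concatenation of the approach [tr] with the loops spelled by [w]; time [a] already belongs to
    the first loop. *)
Definition word_path (T : Type) (a b : nat) (tr : nat -> X) (L : T -> nat -> X)
    (w : nat -> T) : nat -> X :=
  fun i => if (i < a)%N then tr i else L (w ((i - a) %/ b)%N) ((i - a) %% b)%N.

Lemma word_path_loop (T : Type) (a b : nat) (tr : nat -> X) (L : T -> nat -> X)
    (w : nat -> T) (j r : nat) : (r < b)%N ->
  word_path a b tr L w (a + (j * b + r)) = L (w j) r.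
Proof.
move=> rb; rewrite /word_path ltnNge leq_addr/= addKn.
by rewrite modnMDl modn_small// divnMDl ?divn_small ?addn0//; lia.
Qed.

Lemma delta_path_word (delta : R) (T : Type) (a b n : nat) (tr : nat -> X)
    (L : T -> nat -> X) (w : nat -> T) (x0 : X) : (0 < b)%N ->
  delta_path d delta a tr -> tr a = x0 ->
  (forall t, [/\ L t 0%N = x0, L t b = x0 & delta_path d delta b (L t)]) ->
  delta_path d delta n (word_path a b tr L w).
Proof.
move=> b0 trp tra Lp i _; rewrite /word_path.
case: (ltnP i.+1 a) => [ia|]; last rewrite leq_eqVlt => /predU1P[ia|ia].
- by rewrite ifT; [apply: trp|]; exact: ltnW.
- rewrite ia ltnSn subnn div0n mod0n; have [-> _ _] := Lp (w 0%N).
  by rewrite -tra ia; apply: trp; rewrite ia.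
- rewrite ltnNge -ltnS ia/= subSn//.
  set j := (i - a)%N; have [_ Lb Lpath] := Lp (w (j %/ b)%N).
  have jb : (j %% b < b)%N by rewrite ltn_mod.
  rewrite divnS// modnS; case: ifPn => [bj|_]; last first.
    by rewrite add0n; exact: Lpath.
  have [-> _ _] := Lp (w (true + j %/ b)%N); rewrite -Lb.
  (* As [b] divides [j.+1], the index [j] is the last of its block, and the step ends at the closing
     point of the loop. *)
  have bE : b = (j %% b).+1.
    apply/eqP; rewrite eqn_leq jb andbT dvdn_leq//.
    by rewrite -(dvdn_addr _ (dvdn_mull (j %/ b) (dvdnn b))) addnS -divn_eq.
  by have := Lpath _ jb; rewrite -bE.
Qed.

(** Words differing in letter [i] give paths that at time [a + (i * b + h)] are at stage [h] of two
    different loops. *)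
Lemma spath_ge_words (T : finType) (delta Rsep : R) (a b h q : nat)
    (tr : nat -> X) (L : T -> nat -> X) (x x0 : X) (t0 : T) :
  (h < b)%N -> tr 0%N = x -> tr a = x0 -> delta_path d delta a tr ->
  (forall t, [/\ L t 0%N = x0, L t b = x0 & delta_path d delta b (L t)]) ->
  (forall t u, t != u -> Rsep < d (L t h) (L u h)) ->
  ((#|T| ^ q)%:R%:E <= spath d (a + q * b) Rsep delta x)%E.
Proof.
move=> hb tr0 tra trp Lp Lsep; rewrite -card_tuple.
apply: (@spath_family _ (fun w : q.-tuple T =>
  word_path a b tr L (nth t0 w))) => [w|w v wv].
  split; last by apply: delta_path_word trp tra Lp; lia.
  (* For [a = 0] the path starts inside the first loop, and [x = x0]. *)
  rewrite /word_path; case: ltnP => // a0.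
  move: a0 tra; rewrite leqn0 => /eqP ->; rewrite div0n mod0n tr0 => ->.
  by have [] := Lp (nth t0 w 0).
have [i iwv] : exists i : 'I_q, nth t0 w i != nth t0 v i.
  apply: contrapT => nwv; move/negP: wv; apply; apply/eqP/eq_from_tnth => i.
  rewrite !(tnth_nth t0); apply/eqP; apply: contrapT => /negP wvi.
  by apply: nwv; exists i.
apply: (lt_le_trans (Lsep _ _ iwv)).
rewrite -(word_path_loop a tr L (nth t0 w) i hb).
rewrite -(word_path_loop a tr L (nth t0 v) i hb).
apply: path_dist_ge; rewrite leq_add2l.
by rewrite (@leq_trans (i.+1 * b))// ?leq_mul2r ?ltn_ord ?orbT// mulSn; lia.
Qed.

Lemma separated_in_ball (delta0 c Rsep : R) (x : X) :
  bounded_geometry d -> 0 < c -> 0 < Rsep ->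
  (c%:E <
    limn_esup (fun l : nat => ((l%:R)^-1)%:E * lne (Vgrowth d delta0 x l)))%E ->
  forall N, exists l x0, exists2 S : seq X, (N <= l)%N &
    [/\ delta_class d delta0 x x0, pairwise (fun y z => Rsep < d y z) S,
        (forall y, List.In y S -> delta_ball d delta0 x0 l y) &
        expR (l%:R * (c / 2)) <= (size S)%:R].
Proof.
move=> bg c0 Rsep0 /limn_esup_gt_frequently cV N.
have [C dC] := bg _ Rsep0.
(* Taking [l > 2 * C / c] gives [C <= 1 + l * c / 2 <= exp (l * c / 2)], so thinning out costs at
   most half of the rate; [N.+1] keeps [l] positive. *)
have [l] := cV (maxn N.+1 (Num.truncn (2 * C%:R / c)).+1).
rewrite geq_max => /andP[Nl Cl]; have l0 : (0 : R) < l%:R.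
  by rewrite ltr0n (leq_trans _ Nl).
rewrite lte_pdivlMl// -EFinM => cVl.
have /ereal_sup_gt[_ [x0 xx0 <-]] :
    ((expR (l%:R * c))%:E < Vgrowth d delta0 x l)%E.
  by rewrite ltNge; apply/negP => /lne_le_expR; rewrite leNgt cVl.
move=> /ecard_gt[s [us sball cs]].
have [S [sepS Ss sS]] := separated_sublist (ltW Rsep0) dC us.
exists l, x0, S; first exact: ltnW.
split=> //; first by move=> y /Ss /sball.
set e := expR (l%:R * (c / 2)).
have e0 : 0 < e by exact: expR_gt0.
have ee : expR (l%:R * c) = e * e by rewrite -expRD; congr expR; field.
have Ce : C%:R <= e.
  apply: le_trans (expR_ge1Dx _).
  have : 2 * C%:R / c < l%:R.
    by apply: lt_le_trans (truncnS_gt _) _; rewrite ler_nat.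
  by rewrite ltr_pdivrMr//; lra.
rewrite -(ler_pM2l e0) -ee (le_trans (ltW cs))//.
apply: (@le_trans _ _ ((C * size S)%:R)); first by rewrite ler_nat.
by rewrite natrM ler_wpM2r.
Qed.

(** The bound is independent of [Rsep], so it survives the inner limit. *)
Lemma path_entropy_ge (delta0 delta c Rsep : R) (m : nat) (x : X) :
  bounded_geometry d -> 0 <= delta0 -> 0 < c -> (0 < m)%N -> 0 < Rsep ->
  m%:R * delta0 <= delta ->
  (c%:E <
    limn_esup (fun l : nat => ((l%:R)^-1)%:E * lne (Vgrowth d delta0 x l)))%E ->
  ((m%:R * c / 16)%:E <=
    limn_esup (fun n => ((n%:R)^-1)%:E * lne (spath d n Rsep delta x)))%E.
Proof.
move=> bg delta00 c0 m0 Rsep0 mdelta cV.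
have [l [x0 [S ml [[a [tr [tr0 tra trp]]] sepS Sball lS]]]] :=
  separated_in_ball bg c0 Rsep0 cV m.
have S0 : (0 < size S)%N.
  by rewrite -(ltr_nat R); apply: lt_le_trans lS; exact: expR_gt0.
have /choice[p pP] (i : 'I_(size S)) : exists p : nat -> X,
    [/\ p 0%N = x0, p l = nth x0 S i & delta_path d delta0 l p].
  by apply/Sball/(In_nthP x0); exists i.
pose K := (l %/ m).+1.
have delta0_le : delta0 <= delta.
  by apply: le_trans mdelta; rewrite ler_peMl// ler1n.
have words q :
    ((size S ^ q)%:R%:E <= spath d (a + q * (2 * K)) Rsep delta x)%E.
  rewrite -[size S]card_ord.
  apply: (@spath_ge_words _ delta Rsep a (2 * K) K q tr
    (fun i => there_and_back l m (p i)) x x0 (Ordinal S0)) => //.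
  - by rewrite mul2n -addnn -addn1 leq_add2l.
  - by move=> i ia; apply: le_trans delta0_le; exact: trp.
  - move=> i; have [pi0 _ pip] := pP i; split.
    + by rewrite there_and_back0.
    + by rewrite there_and_backN.
    + exact: delta_path_there_and_back mdelta pip.
  - move=> i j ij; rewrite !there_and_back_half//.
    have [_ -> _] := pP i; have [_ -> _] := pP j.
    have far (u v : 'I_(size S)) : (u < v)%N ->
        Rsep < d (nth x0 S u) (nth x0 S v).
      by move=> uv; apply: (pairwiseP x0 sepS) uv; rewrite inE.
    case: (dM) => _ _ dC _.
    by have [/far//|/far|/val_inj] := ltngtP i j; [rewrite dC|move/eqP: ij].
(* Beyond passing [N], having [q > a] makes the approach time negligible. *)
apply: limn_esup_ge => N; pose q := (N + a).+1.
exists (a + q * (2 * K))%N; first by rewrite /q /K; nia.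
apply: growth_rate_ge; first by rewrite /q /K; nia.
apply: le_trans (words q); rewrite lee_fin natrX.
apply: (@le_trans _ _ (expR (l%:R * (c / 2)) ^+ q)).
  rewrite -expRM_natl ler_expR.
  (* From [m <= l] come [2 * K * m <= 4 * l] and [a * m <= q * l]. The factor 8 and the halved rate
     [c / 2] produce the 16. *)
  have : ((a + q * (2 * K)) * m <= 8 * q * l)%N.
    have := leq_divM l m; rewrite /q /K; nia.
  rewrite -(ler_nat R) !natrM => H.
  rewrite [leLHS](_ : _ = (a + q * (2 * K))%:R * m%:R * (c / 16)); last by ring.
  rewrite [leRHS](_ : _ = 8 * q%:R * l%:R * (c / 16)); last by field.
  by rewrite ler_wpM2r// divr_ge0// ltW.
by rewrite lerXn2r ?nnegrE// ltW ?expR_gt0.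
Qed.

(** * Limits in [Rsep] and [delta] *)

Lemma lim_path_entropy (delta : R) (x : X) :
  lim ((fun Rsep : R => limn_esup (fun n : nat =>
    ((n%:R)^-1)%:E * lne (spath d n Rsep delta x))%E) @ +oo) =
  ereal_inf (range (fun Rsep : R => limn_esup (fun n : nat =>
    ((n%:R)^-1)%:E * lne (spath d n Rsep delta x))%E)).
Proof.
(* Families separated at scale [s] are separated at any [r <= s], so the rate is nonincreasing. *)
apply: cvg_lim => //; apply: nonincreasing_cvge => r s rs.
apply: le_limn_esup => n; apply: lee_wpmul2l; first by rewrite lee_fin invr_ge0.
by apply: le_lne; exact: le_spath.
Qed.

End Paths.

Theorem mainTheorem14 (R : realType) (X : Type) (d : X -> X -> R) (x : X) :
  is_metric d -> bounded_geometry d ->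
  ((forall delta : R, 0 < delta ->
      (fun l : nat => ((l%:R)^-1)%:E * lne (Vgrowth d delta x l))%E
        @ \oo --> (0 : \bar R)%E) ->
   coarse_entropy d x = (0 : \bar R)%E) /\
  ((exists delta : R, 0 < delta /\
      ((0 : \bar R) <
        limn_esup (fun l : nat => ((l%:R)^-1)%:E * lne (Vgrowth d delta x l)))%E) ->
   coarse_entropy d x = (+oo)%E).
Proof.
move=> dM bg; split=> [V0|[delta0 [delta00 cV]]]; apply: cvg_lim => //.
  (* The inner limit is exactly 0 for every positive [delta]. *)
  apply: cvg_near_cst; near=> delta.
  have delta0 : 0 < delta by near: delta; exact: nbhs_pinfty_gt.
  rewrite lim_path_entropy//; apply/eqP; rewrite eq_le; apply/andP; split.
    apply/lee_addgt0Pr => eps eps0; rewrite add0e.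
    have [|Rsep] := @path_entropy_le _ _ _ dM _ _ x delta0 eps0.
      by have [_ ->] := cvg_limn_einf_sup (V0 _ delta0); rewrite lte_fin.
    by apply: le_trans; apply: ereal_inf_lbound; exists Rsep.
  apply: le_ereal_inf_tmp => _ [Rsep _ <-]; apply: limn_esup_ge => N.
  exists N => //; apply: mule_ge0; first by rewrite lee_fin invr_ge0.
  by rewrite lne_ge0; apply: spath_ge1 => //; exact: ltW.
have [c c0 cV'] : exists2 c : R, 0 < c & (c%:E <
    limn_esup (fun l => ((l%:R)^-1)%:E * lne (Vgrowth d delta0 x l)))%E.
  (* The upper limit may be [+oo], in which case any positive [c] works. *)
  move: cV; case: (limn_esup _) => [r||//]; last by exists 1; rewrite ?ltry.
  by rewrite lte_fin => r0; exists (r / 2); rewrite ?lte_fin; lra.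
(* This [m] makes [m * c / 16] exceed [M]; then [delta >= m * delta0] holds eventually. *)
apply/cvgeyPge => M; pose m := (Num.truncn (16 * M / c)).+1.
near=> delta.
rewrite lim_path_entropy//; apply: le_ereal_inf_tmp => _ [Rsep _ <-].
apply: (@le_trans _ _ (m%:R * c / 16)%:E).
  have := truncnS_gt (16 * M / c); rewrite -/m ltr_pdivrMr// => Mm.
  by rewrite lee_fin; lra.
(* The infimum runs over all real [Rsep], while the lower bound needs a positive one; enlarging
   [Rsep] only lowers the rate. *)
have max_le : (limn_esup (fun n => (n%:R^-1)%:E *
      lne (spath d n (Num.max Rsep 1%R) delta x)) <=
    limn_esup (fun n => (n%:R^-1)%:E * lne (spath d n Rsep delta x)))%E.
  apply: le_limn_esup => n; apply: lee_wpmul2l.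
    by rewrite lee_fin invr_ge0.
  by apply/le_lne/le_spath; rewrite le_max lexx.
apply: le_trans max_le.
apply: (path_entropy_ge dM bg (ltW delta00) c0 _ _ _ cV') => //.
  by rewrite lt_max ltr01 orbT.
Unshelve. all: by end_near.
Qed.
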